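(* For every $n\in\mathbb N$, $v\in F\mathbb Z$ and $b,m\in\mathbb Z$, \[ \gamma_n\bigl(v\ast(b^m)\bigr)=\gamma_n v+T_n(m,\,b,\,1+\gamma_1v,\,1+\gamma_2v,\,1+\gamma_3 v,\dots). \]
   Context: $\mathbb N=\{1,2,3,\dots\}$, $\mathbb N_0=\mathbb N\cup\{0\}$, and $\mathbb Z^{\mathbb N}$ is the set of all maps $a\colon\mathbb N\to\mathbb Z$, written $a=(a(1),a(2),\dots)$. $(F\mathbb Z,\ast)$ denotes the free group on the set $\mathbb Z$; its elements are called words and are written as formal power products $(b_1^{m_1}\dots b_k^{m_k})$ with $k\in\mathbb N_0$, bases $b_i\in\mathbb Z$ (the free generators) and exponents $m_i\in\mathbb Z$. The identity is the empty word $()$, $\ast$ is concatenation with the only rules $(b^m)\ast(b^n)=(b^{m+n})$ and $(b^0)=()$, and $(b)$ abbreviates $(b^1)$. Powers are formal, so $(z^b)$ is the $b$-th power of the generator $z$. Length and content are the group homomorphisms $\#,|\cdot|\colon(F\mathbb Z,\ast)\to(\mathbb Z,+)$ with $\#(b_1^{m_1}\dots b_k^{m_k})=m_1+\dots+m_k$ and $|(b_1^{m_1}\dots b_k^{m_k})|=m_1b_1+\dots+m_kb_k$. $(\Gamma_z)_{z\in\mathbb Z}$ is the (existing and unique) family of maps $\Gamma_z\colon F\mathbb Z\to F\mathbb Z$ with $\Gamma_z()=()$, $\Gamma_z(b)=(z^b)$ and $\Gamma_z(v\ast w)=\Gamma_zv\ast\Gamma_{z+\#v}w$ for all $z,b\in\mathbb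 Z$, $v,w\in F\mathbb Z$. For $a\in\mathbb Z^{\mathbb N}$ and $n\in\mathbb N_0$, $\Gamma_a^n\colon F\mathbb Z\to F\mathbb Z$ is defined by $\Gamma_a^0=\mathrm{id}$ and $\Gamma_a^{n}w=\Gamma_{a(n)}(\Gamma_a^{n-1}w)$ for $n\ge1$. Vardi's functionals $T_n\colon\mathbb Z^{\mathbb N}\to\mathbb Z$, $n\in\mathbb N_0$, are defined by $T_na:=|\Gamma_a^n(1)|$, where $(1)$ is the word consisting of the generator $1$; $T_n(a_1,a_2,\dots)$ means $T_na$ for $a=(a_1,a_2,\dots)$. Put $\Gamma:=\Gamma_1$ and let $\Gamma^{k}$ be its $k$-fold iterate. For a word $w$ and $n\in\mathbb N$, the $n$-th golombic number of $w$ is $\gamma_nw:=\#\,\Gamma^{n-1}w$. *)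

(* Defs.v *)
From HB Require Import structures.
From mathcomp Require Import all_boot all_order all_algebra.
Set Implicit Arguments.
Unset Strict Implicit.
Unset Printing Implicit Defensive.
Import GRing.Theory.
Local Open Scope ring_scope.

Definition gexpz (G : groupType) (x : G) (m : int) : G :=
  match m with
  | Posz n => (x ^+ n)%g
  | Negz n => (x ^- n.+1)%g
  end.

(* The free group on X: freely reduced sequences of letters, where the letter
   (x, false) is the generator x and (x, true) is its inverse. *)
Section FreeGroup.
Variable X : choiceType.
Implicit Types (x : X * bool) (s t : seq (X * bool)).

Definition linv x := (x.1, ~~ x.2).

Definition reduced s := sorted (fun x y => y != linv x) s.

Record fgroup := FGroup { letters :> seq (X * bool); _ : reduced letters }.

HB.instance Definition _ := [isSub for letters].
HB.instance Definition _ := [Choice of fgroup by <:].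

Definition lcons x s :=
  if s is y :: t then if y == linv x then t else x :: s else [:: x].

Definition lcat s t := foldr lcons t s.

Lemma linvK : involutive linv.
Proof. by case=> b c; rewrite /linv /= negbK. Qed.

Lemma reduced_tail x s : reduced (x :: s) -> reduced s.
Proof. by case: s => //= y s /andP[]. Qed.

Lemma lcons_reduced x s : reduced s -> reduced (lcons x s).
Proof.
case: s => //= y s rs; case: ifP => [_|/negbT nyx] /=; last by rewrite nyx.
exact: (@reduced_tail y).
Qed.

Lemma lcat_reduced s t : reduced t -> reduced (lcat s t).
Proof. by move=> rt; elim: s => //= x s; apply: lcons_reduced. Qed.

Lemma lconsK x s : reduced s -> lcons x (lcons (linv x) s) = s.
Proof.
case: s => [|y s]; first by rewrite /= eqxx.
rewrite /= linvK; case: eqP => [->|_] /=; last by rewrite eqxx.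
by case: s => //= z s /andP[/negbTE->].
Qed.

Lemma lcat_lcons x s t :
  reduced t -> lcat (lcons x s) t = lcons x (lcat s t).
Proof.
case: s => //= y s rt; case: eqP => //= ->.
by rewrite lconsK //; apply: lcat_reduced.
Qed.

Lemma lcatA s t u : reduced u -> lcat s (lcat t u) = lcat (lcat s t) u.
Proof. by move=> ru; elim: s => //= x s ->; rewrite lcat_lcons. Qed.

Lemma lcats0 s : reduced s -> lcat s [::] = s.
Proof.
elim: s => //= x [|y s] IHs //= /andP[/negbTE nyx rs].
by move: (IHs rs) => /= ->; rewrite /= nyx.
Qed.

Definition lrev s := rev (map linv s).

Lemma lrevK s : lrev (lrev s) = s.
Proof.
by rewrite /lrev map_rev revK -map_comp map_id_in // => x _ /=; rewrite linvK.
Qed.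

Lemma lrev_reduced s : reduced s -> reduced (lrev s).
Proof.
rewrite /reduced /lrev rev_sorted sorted_map; apply: sub_sorted => x y /=.
by rewrite linvK eq_sym.
Qed.

Lemma lcatVs s : reduced s -> lcat (lrev s) s = [::].
Proof.
elim: s => //= x s IHs rs; rewrite /lrev /= rev_cons /lcat foldr_rcons /=.
by rewrite linvK eqxx; apply: IHs; apply: reduced_tail rs.
Qed.

Lemma reduced_letters (w : fgroup) : reduced w.
Proof. by case: w. Qed.

Definition fgmul (v w : fgroup) := FGroup (lcat_reduced v (reduced_letters w)).
Definition fginv (w : fgroup) := FGroup (lrev_reduced (reduced_letters w)).
Definition fgone := @FGroup [::] isT.

Lemma fgmulA : associative fgmul.
Proof. by move=> u v w; apply/val_inj/lcatA/reduced_letters. Qed.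

Lemma fgmul1w : left_id fgone fgmul.
Proof. by move=> w; apply/val_inj. Qed.

Lemma fgmulw1 : right_id fgone fgmul.
Proof. by move=> w; apply/val_inj/lcats0/reduced_letters. Qed.

Lemma fgmulVw : left_inverse fgone fginv fgmul.
Proof. by move=> w; apply/val_inj/lcatVs/reduced_letters. Qed.

Lemma fgmulwV : right_inverse fgone fginv fgmul.
Proof.
move=> w; apply/val_inj; rewrite /= -{1}[letters w]lrevK.
exact/lcatVs/lrev_reduced/reduced_letters.
Qed.

HB.instance Definition _ :=
  isGroup.Build fgroup fgmulA fgmul1w fgmulw1 fgmulVw fgmulwV.

Definition gen (b : X) : fgroup := @FGroup [:: (b, false)] isT.

Lemma fgroup_ind (P : fgroup -> Prop) :
    P 1%g ->
    (forall b w, P w -> P (gen b * w)%g) ->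
    (forall b w, P w -> P ((gen b)^-1 * w)%g) ->
  forall w, P w.
Proof.
move=> P1 Pg Pv [s rs]; elim: s rs => [|[b c] s IHs] rs.
  by rewrite (_ : FGroup rs = 1%g) //; apply: val_inj.
have rs' := reduced_tail rs; have {}IHs := IHs rs'.
have lE : lcons (b, c) s = (b, c) :: s.
  by case: (s) rs => //= y t /andP[/negbTE->].
case: c rs lE => rs lE.
  rewrite (_ : FGroup rs = (gen b)^-1 * FGroup rs')%g; first exact: Pv.
  exact: val_inj.
rewrite (_ : FGroup rs = gen b * FGroup rs')%g; first exact: Pg.
exact: val_inj.
Qed.

Definition fgext (G : groupType) (f : X -> G) (w : fgroup) : G :=
  (\prod_(x <- letters w) if x.2 then (f x.1)^-1 else f x.1)%g.

Lemma fgextM (G : groupType) (f : X -> G) : {morph fgext f : v w / (v * w)%g}.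
Proof.
move=> v w; rewrite /fgext /=; elim: (letters v) => [|x s IHs] /=.
  by rewrite big_nil mul1g.
rewrite big_cons -mulgA -{}IHs; case: (lcat s w) => [|y t] /=.
  by rewrite big_cons.
case: eqP => [->|_]; rewrite !big_cons //= mulgA.
by case: x.2; rewrite /= ?mulVg ?mulgV mul1g.
Qed.

Lemma fgext_gen (G : groupType) (f : X -> G) b : fgext f (gen b) = f b.
Proof. by rewrite /fgext big_seq1. Qed.

Lemma fgext_unique (G : groupType) (f : X -> G) (h : fgroup -> G) :
  {morph h : v w / (v * w)%g} -> (forall b, h (gen b) = f b) -> h =1 fgext f.
Proof.
move=> hM hg.
have h1 : h 1%g = 1%g by apply: (mulgI (h 1%g)); rewrite -hM !mulg1.
have hV b : h (gen b)^-1%g = (f b)^-1%g.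
  by apply: (mulgI (f b)); rewrite -hg -hM !mulgV.
have e1 : fgext f 1%g = 1%g by rewrite /fgext big_nil.
have eV b : fgext f (gen b)^-1%g = (f b)^-1%g by rewrite /fgext big_seq1.
elim/fgroup_ind=> [|b w IHw|b w IHw]; first by rewrite h1 e1.
  by rewrite hM fgextM IHw hg fgext_gen.
by rewrite hM fgextM IHw hV eV.
Qed.

End FreeGroup.

Notation word := (fgroup int).

(* The word (b^m). *)
Definition wpow (b m : int) : word := gexpz (gen b) m.

Definition wlen (w : word) : int := \sum_(x <- letters w) (-1) ^+ x.2.
Definition wcontent (w : word) : int :=
  \sum_(x <- letters w) (-1) ^+ x.2 * x.1.

Lemma wsumM (f : int -> int) (v w : word) :
  \sum_(x <- letters (v * w)%g) (-1) ^+ x.2 * f x.1 =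
  \sum_(x <- letters v) (-1) ^+ x.2 * f x.1 +
  \sum_(x <- letters w) (-1) ^+ x.2 * f x.1.
Proof.
rewrite /=; elim: (letters v) => [|x s IHs] /=; first by rewrite big_nil add0r.
rewrite big_cons -addrA -{}IHs; case: (lcat s w) => [|y t] /=.
  by rewrite big_cons.
case: eqP => [->|_]; rewrite !big_cons //= addrA.
by case: x.2; rewrite /= ?mulN1r ?mul1r ?addrN ?addNr add0r.
Qed.

Lemma wlenE w : wlen w = \sum_(x <- letters w) (-1) ^+ x.2 * 1.
Proof. by apply: eq_bigr => x _; rewrite mulr1. Qed.

Lemma wlenM (v w : word) : wlen (v * w)%g = wlen v + wlen w.
Proof. by rewrite !wlenE (wsumM (fun=> 1)). Qed.

Lemma wcontentM (v w : word) : wcontent (v * w)%g = wcontent v + wcontent w.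
Proof. exact: (wsumM id). Qed.

Lemma morph_wpow (h : word -> int) :
  {morph h : v w / (v * w)%g >-> v + w} ->
  forall b m, h (wpow b m) = m * h (gen b).
Proof.
move=> hM b m.
have h1 : h 1%g = 0 by apply: (addrI (h 1%g)); rewrite -hM mulg1 addr0.
have hX n : h (gen b ^+ n)%g = n%:Z * h (gen b).
  elim: n => [|n IHn]; first by rewrite h1 mul0r.
  by rewrite expgS hM IHn -[n.+1]add1n PoszD mulrDl mul1r.
case: m => n /=; first exact: hX.
apply: (addrI (h (gen b ^+ n.+1)%g)).
by rewrite -hM mulgV h1 hX NegzE mulNr addrN.
Qed.

Lemma wlen_pow (b m : int) : wlen (wpow b m) = m.
Proof. by rewrite (morph_wpow wlenM) /wlen big_seq1 mulr1. Qed.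

Lemma wcontent_pow (b m : int) : wcontent (wpow b m) = m * b.
Proof. by rewrite (morph_wpow wcontentM) /wcontent big_seq1 mul1r. Qed.

(* The value on the inverse letter is forced by
   1 = Gamma_z (b^-1 * b) = Gamma_z (b^-1) * Gamma_(z-1) (b). *)
Fixpoint Gamma_letters (z : int) (s : seq (int * bool)) : word :=
  match s with
  | [::] => 1%g
  | (b, false) :: t => (wpow z b * Gamma_letters (z + 1) t)%g
  | (b, true) :: t => ((wpow (z - 1) b)^-1 * Gamma_letters (z - 1) t)%g
  end.

Definition Gamma (z : int) (w : word) : word := Gamma_letters z w.

Lemma Gamma1 z : Gamma z 1%g = 1%g.
Proof. by []. Qed.

Lemma Gamma_gen z b : Gamma z (gen b) = wpow z b.
Proof. by rewrite /Gamma /= mulg1. Qed.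

Lemma GammaM z (v w : word) :
  Gamma z (v * w)%g = (Gamma z v * Gamma (z + wlen v) w)%g.
Proof.
rewrite /Gamma /wlen /=.
elim: (letters v) z => [|[b c] s IHs] z /=; first by rewrite big_nil addr0 mul1g.
transitivity (Gamma_letters z [:: (b, c)] *
              Gamma_letters (z + (-1) ^+ c) (lcat s w))%g; last first.
  by rewrite IHs big_cons /= !addrA; case: c => /=; rewrite mulg1 !mulgA.
case: (lcat s w) => [|[d e] t] /=; first by case: c; rewrite /= !mulg1.
case: eqP => [[-> ->]|_]; last by case: c; rewrite /= mulg1.
by case: c; rewrite /= mulg1 mulgA ?subrK ?addrK ?mulVg ?mulgV mul1g.
Qed.

Lemma Gamma_unique (G : int -> word -> word) :
    (forall z, G z 1%g = 1%g) ->
    (forall z b, G z (gen b) = wpow z b) ->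
    (forall z v w, G z (v * w)%g = (G z v * G (z + wlen v) w)%g) ->
  forall z w, G z w = Gamma z w.
Proof.
move=> G1 Gg GM z w; elim/fgroup_ind: w z => [|b w IHw|b w IHw] z.
- by rewrite G1.
- by rewrite GM GammaM Gg Gamma_gen IHw.
rewrite GM GammaM IHw; congr (_ * _)%g.
have lV : wlen (gen b)^-1%g = -1 by rewrite /wlen big_seq1.
apply: (mulIg (wpow (z - 1) b)).
by rewrite -{1}Gg -Gamma_gen -lV -GM -GammaM mulVg G1.
Qed.

(* A map a from {1, 2, ...} to the integers is encoded 0-based as
   a : nat -> int, so a k stands for a(k + 1). *)
Fixpoint Gamma_iter (a : nat -> int) (n : nat) (w : word) : word :=
  if n is k.+1 then Gamma (a k) (Gamma_iter a k w) else w.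

Definition vardi (n : nat) (a : nat -> int) : int :=
  wcontent (Gamma_iter a n (gen 1)).

(* Meaningful for n >= 1 only. *)
Definition golombic (n : nat) (w : word) : int :=
  wlen (iter n.-1 (Gamma 1) w).

(* Main.v *)
Require Import Defs.
From mathcomp Require Import all_boot all_order all_algebra.
Import GRing.Theory.
Local Open Scope ring_scope.

(** Applying [Gamma 1] to a product [v * w] applies [Gamma 1] to [v] and
    [Gamma (1 + wlen v)] to [w]. Iterating, the left factor runs through the
    [Gamma 1]-orbit of [v], whose lengths are the golombic numbers of [v], so
    the right factor undergoes the transformations of index
    [1 + golombic 1 v], [1 + golombic 2 v], ... ([iter_Gamma_mul]).
    For [w = wpow b m] this right factor is a continuation of Vardi's iteration:
    the word [(b^m)] is what the indices [m] and [b] make of [(1)].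

    After [n - 1] steps the right factor is thus the word that Vardi's iteration
    reaches after [n + 1] steps, and its length is what the left factor's
    length has to be corrected by. Since [Gamma z] turns content into length
    whatever [z] is ([wlen_Gamma]), that length is the content of the word one
    step earlier, which is the value of [T_n]. *)

Lemma wlenV (w : word) : wlen w^-1%g = - wlen w.
Proof.
have wlen1 : wlen 1%g = 0 by rewrite /wlen big_nil.
by apply: (addrI (wlen w)); rewrite -wlenM mulgV addrN wlen1.
Qed.

(** Each letter [b] becomes a [b]-th power of a generator; the index only
    determines which generator, and the length does not see it. *)
Lemma wlen_Gamma (z : int) (w : word) : wlen (Gamma z w) = wcontent w.
Proof.
rewrite /Gamma /wcontent; elim: (letters w) z => [|[b c] s IHs] z /=.
  by rewrite /wlen !big_nil.
rewrite big_cons; case: c => /=; rewrite wlenM IHs ?wlenV wlen_pow.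
  by rewrite mulN1r.
by rewrite mul1r.
Qed.

Lemma iter_Gamma_mul (k : nat) (v w : word) :
  iter k (Gamma 1) (v * w)%g =
  (iter k (Gamma 1) v * Gamma_iter (fun j => 1 + golombic j.+1 v) k w)%g.
Proof. by elim: k => //= k ->; rewrite GammaM. Qed.

Lemma Gamma_iter_addn (a : nat -> int) (i k : nat) (w : word) :
  Gamma_iter a (k + i) w =
  Gamma_iter (fun j => a (j + i)%N) k (Gamma_iter a i w).
Proof. by elim: k => //= k ->. Qed.

Lemma eq_Gamma_iter (a a' : nat -> int) (k : nat) (w : word) :
  a =1 a' -> Gamma_iter a k w = Gamma_iter a' k w.
Proof. by move=> eqa; elim: k => //= k ->; rewrite eqa. Qed.

(** The indices [m] and [b] lead from [(1)] over [(m)] to [(b^m)]. *)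
Lemma Gamma_iter2 (a : nat -> int) :
  Gamma_iter a 2 (gen 1) = wpow (a 1%N) (a 0%N).
Proof. by rewrite /= Gamma_gen -[RHS]Gamma_gen. Qed.

Theorem theorem3p11 (n : nat) (hn : (0 < n)%N) (v : word) (b m : int) :
  golombic n (v * wpow b m)%g =
  golombic n v +
  vardi n (fun k : nat =>
    match k with
    | 0%N => m
    | 1%N => b
    | j.+2 => 1 + golombic j.+1 v
    end).
Proof.
set a := fun k : nat => _.
(* Any index turns content into length; [a n] makes this extra step the next
   one of the same iteration. *)
rewrite /vardi -(wlen_Gamma (a n)) -/(Gamma_iter a n.+1 (gen 1)).
case: n hn => // n _.
rewrite -addn2 Gamma_iter_addn Gamma_iter2 {1}/golombic iter_Gamma_mul wlenM.
by congr (_ + wlen _); apply: eq_Gamma_iter => j; rewrite addn2.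
Qed.
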